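(* Let $k\geq 2$ and let $d_1=1$, $d_2\geq2,\dots,d_{k-1}\geq2$, $d_k\geq1$ be integers. Then the characteristic polynomial of the line graph $L(B(d_1,\dots,d_k))$ of the generalized Bethe tree $B(d_1,\dots,d_k)$ is \[ \chi_{L(B(d_1,\dots,d_k))}(\lambda)=\frac{1}{\lambda+2}\prod_{l=1}^{k} g_l(\lambda)^{\sigma_l}. \] Moreover, the smallest eigenvalue of $L(B(d_1,\dots,d_k))$ depends only on $d_2,\dots,d_{k-1}$, and is independent of $d_k$, as long as $d_k\geq2$.
   Context: All graphs are finite, undirected and simple; $\chi_G(\lambda)=\det(\lambda I-A(G))$ is the characteristic polynomial of the adjacency matrix $A(G)$ of a graph $G$, and eigenvalues of $G$ are eigenvalues of $A(G)$. $L(G)$ denotes the line graph of $G$. For integers $d_1=1$, $d_2\geq2,\dots,d_{k-1}\geq2$, $d_k\geq1$ with $k\ge 2$, $B(d_1,\dots,d_k)$ is the generalized Bethe tree: the rooted tree with $k$ levels (the root being at level $1$) in which every vertex at level $j$ has degree $d_{k-j+1}$. Thus the root has degree $d_k$ and the leaves at level $k$ have degree $d_1=1$. Set \[ m_l=d_k\prod_{i=l+1}^{k-1}(d_i-1)\quad(l=0,1,\dots,k-1),\qquad m_k=1, \] \[ \sigma_l=m_l-m_{l+1}\quad(l=0,1,\dots,k-1),\qquad \sigma_k=1, \] where empty products equal $1$ (so $\sigma_{k-1}=d_k-1$). The polynomials $g_i(\lambda)$ ($i=0,1,\dots,k$) associated with $(d_1,\dots,d_k)$ are defined by $g_0(\lambda)=1$,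 $g_1(\lambda)=\lambda+1$, \[ g_i(\lambda)=(\lambda+2-d_i)g_{i-1}(\lambda)-(d_i-1)g_{i-2}(\lambda)\quad(i=2,\dots,k-1), \] \[ g_k(\lambda)=(\lambda+2-d_k)g_{k-1}(\lambda)-d_k\,g_{k-2}(\lambda). \] *)

(* Defs.v *)
From HB Require Import structures.
From mathcomp Require Import all_boot all_order all_algebra.
Set Implicit Arguments.
Unset Strict Implicit.
Unset Printing Implicit Defensive.
Import Order.TTheory GRing.Theory Num.Theory.
Local Open Scope ring_scope.

Record sgraph := SGraph {
  vertex :> finType;
  adj : rel vertex;
  adj_sym : symmetric adj;
  adj_irr : irreflexive adj }.

Definition edge_set (G : sgraph) : {set {set G}} :=
  [set E : {set G} | [exists x, exists y, adj x y && (E == [set x; y])]].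

Definition edge (G : sgraph) : finType := {E : {set G} | E \in edge_set G}.

Definition line_adj (G : sgraph) : rel (edge G) :=
  fun E F => (E != F) && (val E :&: val F != set0).

Lemma line_adj_sym (G : sgraph) : symmetric (@line_adj G).
Proof. by move=> E F; rewrite /line_adj eq_sym setIC. Qed.

Lemma line_adj_irr (G : sgraph) : irreflexive (@line_adj G).
Proof. by move=> E; rewrite /line_adj eqxx. Qed.

Definition line_graph (G : sgraph) : sgraph :=
  SGraph (@line_adj_sym G) (@line_adj_irr G).

Definition adjacency_matrix (R : pzSemiRingType) (G : sgraph) : 'M[R]_#|G| :=
  \matrix_(i, j) (adj (enum_val i) (enum_val j))%:R.

Definition smallest_eigenvalue (R : rcfType) (n : nat) (A : 'M[R]_n) (a : R) :
    Prop :=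
  eigenvalue A a /\ (forall b : R, eigenvalue A b -> a <= b).

Definition degree (G : sgraph) (x : G) : nat := #|[set y | adj x y]|.

Definition connected_graph (G : sgraph) : Prop :=
  forall x y : G, connect (@adj G) x y.

(* A cyclic sequence of size 2 satisfying [ucycle] just runs along one edge
   and back, so only sizes at least 3 are cycles of the graph. *)
Definition acyclic_graph (G : sgraph) : Prop :=
  forall c : seq G, ucycle (@adj G) c -> (size c < 3)%N.

Definition is_tree (G : sgraph) : Prop := connected_graph G /\ acyclic_graph G.

Definition walk_of_length (G : sgraph) (n : nat) (x y : G) : bool :=
  [exists p : n.-tuple G, path (@adj G) x p && (last x p == y)].

(* Distances between connected vertices are less than [#|G|]; the value is
   [#|G|] when there is no walk from [x] to [y]. *)
Definition distance (G : sgraph) (x y : G) : nat :=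
  find (fun n => walk_of_length n x y) (iota 0 #|G|).

Definition level (G : sgraph) (r x : G) : nat := (distance r x).+1.

(* [d] is indexed from 1 as in (d_1, ..., d_k); only [d 1], ..., [d k] matter.
   Levels do not exceed [k], so the subtraction is exact. *)
Definition generalized_Bethe_tree (k : nat) (d : nat -> nat)
    (G : sgraph) (r : G) : Prop :=
  [/\ is_tree G,
      \max_(x : G) level r x = k
    & forall x : G, degree x = d (k - level r x + 1)%N].

Definition bethe_m (k : nat) (d : nat -> nat) (l : nat) : nat :=
  if l == k then 1%N else (d k * \prod_(l.+1 <= i < k) (d i - 1))%N.

(* For 1 <= l <= k, under d_2, ..., d_(k-1) >= 2 and d_k >= 1, the difference is
   nonnegative and the truncated subtraction is exact; sigma_0 is negative and
   is not represented. *)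
Definition bethe_sigma (k : nat) (d : nat -> nat) (l : nat) : nat :=
  if l == k then 1%N else (bethe_m k d l - bethe_m k d l.+1)%N.

Fixpoint bethe_g (R : nzRingType) (k : nat) (d : nat -> nat) (i : nat) :
    {poly R} :=
  match i with
  | 0 => 1
  | S i1 =>
    match i1 with
    | 0 => 'X + 1
    | S i2 =>
      ('X + 2%:R - (d i)%:R) * bethe_g R k d i1
      - (if i == k then (d k)%:R else (d i)%:R - 1) * bethe_g R k d i2
    end
  end.

(* Main.v *)
Require Import Defs.
From mathcomp Require Import all_boot all_order all_algebra.
From mathcomp Require Import fingroup perm fraction polyrcf zify ring.
Set Implicit Arguments.
Unset Strict Implicit.
Unset Printing Implicit Defensive.
Import Order.TTheory GRing.Theory Num.Theory.
Local Open Scope ring_scope.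

(** The vertex-edge incidence matrix [N] of a graph satisfies
    [N^T N = 2 + A(L(G))] and [N N^T = D + A(G)], with [D] the diagonal matrix of
    the degrees.  A tree has one more vertex than edges, so comparing the
    characteristic polynomials of the two products gives
    [(X + 2) chi_L(X) = det((X + 2) - D - A(G))] (char_poly_line_graph_tree).

    The right-hand determinant is computed by eliminating the tree from its
    leaves: over the field of fractions it is the product of pivots [a x]
    indexed by the vertices, where [a x] plus the inverses of the pivots of the
    children of [x] is the diagonal entry at [x] (det_tree_elimination).  In a
    Bethe tree the pivot only depends on the level, and the recurrence for the
    [g_l] says exactly that it is [g_l / g_(l-1)] at the vertices at distance
    [k - l] from the root (bethe_g_ratio).  There are [m_l] of them, and the
    product of the [(g_l / g_(l-1)) ^ m_l] telescopes to that of the [g_l ^ (m_l - m_(l+1))].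
    The level structure (every vertex but the root has exactly one neighbour
    that is not farther from the root, and this neighbour is strictly nearer)
    is deduced from the absence of cycles (lower_neighbour_unique, adjE).

    For the smallest eigenvalue, put [s_l = (-1)^l g_l].  By interlacing, the
    polynomials [s_1, ..., s_(k-1)] have strictly decreasing smallest roots, and
    all of them are positive below the smallest root [a] of [s_(k-1)]
    (bethe_first_root).  Moreover [s_k] is [- (X + 2)] times a polynomial that is
    positive wherever [s_0, ..., s_(k-1)] are (bethe_s_last, bethe_q_ge0); this
    factor [X + 2] is the one divided out of the product, so the characteristic
    polynomial does not vanish below [a].  It vanishes at [a] as soon as the
    exponent [d_k - 1] of [g_(k-1)] is positive, and [a] does not involve
    [d_k]. *)

(** * Two determinant identities and elimination on a forest *)

(** Only the identity contributes to the Leibniz formula: a permutation whose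
    term is nonzero never decreases [h], and it preserves the sum of the values
    of [h], so it preserves [h] and hence every index.  A height function
    avoids reordering the indices to make the matrix triangular. *)
Lemma det_triangular_height (K : comNzRingType) n (A : 'M[K]_n) (h : 'I_n -> nat) :
    (forall i j, A i j != 0 -> i != j -> (h i < h j)%N) ->
  \det A = \prod_i A i i.
Proof.
move=> hA; rewrite /determinant (bigD1 (1%g : {perm 'I_n})) //= odd_perm1 expr0 mul1r.
rewrite [X in _ + X]big1 ?addr0; first by apply: eq_bigr => i _; rewrite perm1.
move=> s s_neq1; apply/eqP/negPn/negP=> nz.
have nzA i : A i (s i) != 0.
  by apply: contraNneq nz => Ai0; rewrite (bigD1 i) //= Ai0 mul0r mulr0.
have le_h i : (h i <= h (s i))%N.
  case: (eqVneq i (s i)) => [<- //|nsi]; exact/ltnW/hA.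
(* Termwise inequalities with equal sums are equalities. *)
have eq_h : forall i, true -> h i = h (s i).
  have sum_h : (\sum_i h i == \sum_i h (s i))%N.
    by rewrite (reindex_inj (@perm_inj _ s)).
  have:= leqif_sum (fun i (_ : true) => leqif_eq (le_h i)).
  case=> _; rewrite sum_h => /esym/forallP all_h i _.
  by apply/eqP; have := all_h i.
move: s_neq1; apply/negP/negPn/eqP/permP=> i; rewrite perm1.
apply/eqP; rewrite eq_sym; apply/negPn/negP=> nsi.
by have := hA _ _ (nzA i) nsi; rewrite -eq_h // ltnn.
Qed.

(** Both sides are [c ^+ n] times the determinant of the block matrix with
    diagonal blocks [c] and [1] and off-diagonal blocks [N] and [P]: they come
    from clearing the lower left block by column, resp. row operations. *)
Lemma det_scalar_sub_mulmxC (K : comNzRingType) m n (c : K) (N : 'M[K]_(m, n))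
    (P : 'M[K]_(n, m)) :
  c ^+ n * \det (c%:M - N *m P) = c ^+ m * \det (c%:M - P *m N).
Proof.
pose B := block_mx (c%:M : 'M_m) N P (1%:M : 'M_n).
have <- : \det B = \det (c%:M - N *m P).
  transitivity (\det (B *m block_mx 1%:M 0 (- P) 1%:M)).
    by rewrite det_mulmx det_lblock !det1 !mulr1.
  rewrite mulmx_block !mulmx1 !mulmx0 !mul1mx !add0r subrr mulmxN.
  by rewrite det_ublock det1 mulr1.
transitivity (\det (block_mx 1%:M 0 (- P) c%:M *m B)).
  by rewrite det_mulmx det_lblock det1 det_scalar mul1r.
rewrite mulmx_block !mul1mx !mul0mx !addr0 !mulmx1 !mulNmx scalar_mxC addNr.
by rewrite det_ublock det_scalar addrC.
Qed.

(** Elimination from the leaves: [c x y] says that [y] is a child of [x], and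
    [a x] is the pivot left at [x] once its children are eliminated.  The
    matrix is [U *m diag a *m U^T] where [U] is unipotent, with the entry
    [- (a y)^-1] from a parent to its child [y].  Two different vertices have no
    common child, so nothing else appears off the diagonal. *)
Lemma det_tree_elimination (K : fieldType) n (c : rel 'I_n) (h : 'I_n -> nat)
    (w a : 'I_n -> K) :
    (forall x y, c x y -> (h x < h y)%N) ->
    (forall x x' y, c x y -> c x' y -> x = x') ->
    (forall x y, c x y -> a y != 0) ->
    (forall x, w x = a x + \sum_(y | c x y) (a y)^-1) ->
  \det (\matrix_(x, y) (if x == y then w x else - (c x y || c y x)%:R)) =
  \prod_x a x.
Proof.
move=> ch cu ca wE.
pose U : 'M[K]_n :=
  \matrix_(x, y) (if x == y then 1 else if c x y then - (a y)^-1 else 0).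
have cxx x : c x x = false by apply/negP=> /ch; rewrite ltnn.
have detU : \det U = 1.
  rewrite (@det_triangular_height _ _ _ h).
    by rewrite big1 // => i _; rewrite mxE eqxx.
  move=> i j; rewrite mxE; case: (i =P j) => // _.
  by case: ifP => [/ch //|_]; rewrite eqxx.
suff -> : \matrix_(x, y) (if x == y then w x else - (c x y || c y x)%:R) =
          U *m diag_mx (\row_x a x) *m U^T.
  rewrite !det_mulmx det_tr detU mul1r mulr1 det_diag.
  by apply: eq_bigr => i _; rewrite mxE.
apply/matrixP=> x z; rewrite mul_mx_diag mxE [RHS]mxE.
under eq_bigr do rewrite !mxE.
case: eqVneq => [<-|nxz].
  (* On the diagonal, [y = x] gives the pivot and each child [y] its inverse. *)
  rewrite (bigD1 x) //= eqxx mul1r mulr1 wE; congr (_ + _).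
  rewrite [RHS](bigID (c x)) /= [X in _ + X]big1 => [|y /andP[nyx /negPf ->]].
    rewrite addr0 (eq_bigl (fun y => (y != x) && c x y)) => [|y].
      apply: eq_bigr => y /andP[nyx cxy].
      by rewrite eq_sym (negPf nyx) cxy mulNr mulrNN mulVf ?mul1r ?(ca _ _ cxy).
    by case: eqVneq => // ->; rewrite cxx.
  by rewrite eq_sym (negPf nyx) mul0r mul0r.
have nzx : z != x by rewrite eq_sym.
(* Off the diagonal, only the terms [y = x] and [y = z] can be nonzero. *)
rewrite (bigD1 x) //= (bigD1 z) //= !eqxx (negPf nxz) (negPf nzx).
rewrite mul1r mulr1 big1 => [|y /andP[nyx nyz]].
  rewrite addr0; case cxz: (c x z); case czx: (c z x) => /=.
  - by have := ltn_trans (ch _ _ cxz) (ch _ _ czx); rewrite ltnn.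
  - by rewrite mulr0 add0r mulNr mulVf ?(ca _ _ cxz).
  - by rewrite mul0r addr0 mulrN mulfV ?(ca _ _ czx).
  - by rewrite mulr0 mul0r addr0 oppr0.
rewrite ![_ == y]eq_sym (negPf nyx) (negPf nyz).
case cxy: (c x y); last by rewrite !mul0r.
case czy: (c z y); last by rewrite mulr0.
by rewrite (cu _ _ _ cxy czy) eqxx in nxz.
Qed.

(** * Distances and the parent relation of a rooted tree *)

Lemma adj_neq (G : sgraph) (x y : G) : adj x y -> x != y.
Proof. by apply: contraTneq => ->; rewrite adj_irr. Qed.

Lemma walk_of_lengthP (G : sgraph) n (x y : G) :
  reflect (exists p, [/\ size p = n, path (@adj G) x p & last x p = y])
          (walk_of_length n x y).
Proof.
apply: (iffP existsP) => [[p /andP[xp /eqP py]]|[p [sp xp py]]].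
  by exists p; rewrite size_tuple.
by exists (tcast sp (in_tuple p)); rewrite val_tcast xp py /=.
Qed.

Lemma distance_le_walk (G : sgraph) n (x y : G) :
  walk_of_length n x y -> (distance x y <= n)%N.
Proof.
move=> wn; rewrite leqNgt; apply/negP => lt_nd.
have lt_nG : (n < #|G|)%N.
  by apply: leq_trans lt_nd _; rewrite -[leqRHS](size_iota 0) find_size.
by have := before_find 0%N lt_nd; rewrite nth_iota // add0n wn.
Qed.

(** A shortest path has fewer than [#|G|] edges, so the bounded search in
    [distance] does succeed. *)
Lemma walk_of_distance (G : sgraph) (x y : G) :
  connect (@adj G) x y -> walk_of_length (distance x y) x y.
Proof.
case/connectP=> p0 /shortenP[p xp up _ ->{p0}].
have lt_pG : (size p < #|G|)%N.
  by rewrite -[(_ < _)%N]/(size (x :: p) <= _)%N -(card_uniqP up) max_card.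
have hasw : has (fun n => walk_of_length n x (last x p)) (iota 0 #|G|).
  apply/hasP; exists (size p); first by rewrite mem_iota.
  by apply/walk_of_lengthP; exists p.
have lt_dG : (distance x (last x p) < #|G|)%N.
  by move: hasw; rewrite has_find size_iota.
by have := nth_find 0%N hasw; rewrite nth_iota.
Qed.

Lemma distance_refl (G : sgraph) (x : G) : distance x x = 0%N.
Proof.
apply/eqP; rewrite -leqn0; apply: distance_le_walk.
by apply/walk_of_lengthP; exists [::].
Qed.

Section RootedTree.

Variables (G : sgraph) (r : G).
Hypothesis treeG : is_tree G.

Let conG : connected_graph G := proj1 treeG.
Let acG : acyclic_graph G := proj2 treeG.

Lemma distance_eq0 x : (distance r x == 0%N) = (x == r).
Proof.
apply/eqP/eqP => [dx0|->]; last exact: distance_refl.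
have /walk_of_lengthP[p []] := walk_of_distance (conG r x).
by rewrite dx0 => /size0nil -> _ <-.
Qed.

Lemma distance_adj x y : adj x y -> (distance r y <= (distance r x).+1)%N.
Proof.
move=> xy; have /walk_of_lengthP[p [sp rp px]] := walk_of_distance (conG r x).
apply: distance_le_walk; apply/walk_of_lengthP; exists (rcons p y).
by rewrite size_rcons sp rcons_path rp px last_rcons.
Qed.

(** The last but one vertex of a shortest walk from the root. *)
Lemma distance_pred x : x != r ->
  exists2 y, adj y x & distance r x = (distance r y).+1.
Proof.
rewrite -distance_eq0 -lt0n => dx.
have /walk_of_lengthP[p []] := walk_of_distance (conG r x).
case/lastP: p => [/= sp|p z]; first by rewrite -sp in dx.
rewrite size_rcons rcons_path last_rcons => sp /andP[rp lz] zx.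
rewrite zx in lz; exists (last r p) => //.
apply/eqP; rewrite eqn_leq distance_adj //= -sp ltnS.
by apply: distance_le_walk; apply/walk_of_lengthP; exists p.
Qed.

(** A simple path of positive length from [y] to [z] that misses [x] closes up
    through [x] into a cycle of length at least 3. *)
Lemma acyclic_avoid x y z : adj x y -> adj x z ->
  connect (fun u v : G => [&& adj u v, u != x & v != x]) y z -> y = z.
Proof.
move=> xy xz /connectP[p0 /shortenP[p yp up _] zE]; subst z.
case: p yp up xz => // y1 p yp up xz; exfalso.
have avoid_x u q : path (fun u v : G => [&& adj u v, u != x & v != x]) u q ->
    path (@adj G) u q /\ x \notin q.
  elim: q u => //= v q IHq u /andP[/and3P[uv ux vx] /IHq[-> xq]].
  by rewrite uv inE negb_or eq_sym vx.
have [ap xp] := avoid_x _ _ yp.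
have /acG : ucycle (@adj G) (x :: y :: y1 :: p).
  rewrite /ucycle /= in ap xz up *.
  apply/andP; split; last by rewrite inE negb_or (adj_neq xy) xp.
  move: ap => /= /andP[-> ap]; rewrite xy rcons_path ap /=.
  by rewrite adj_sym.
by [].
Qed.

(** A shortest walk from the root to [v] meets only vertices nearer than [v]
    before it reaches [v], so it misses [x]. *)
Lemma connect_avoid x v : v != x -> (distance r v <= distance r x)%N ->
  connect (fun u v : G => [&& adj u v, u != x & v != x]) r v.
Proof.
move Dn: (distance r v) => n; elim: n v Dn => [|n IHn] v dv vx lt_nx.
  by move/eqP: dv; rewrite distance_eq0 => /eqP->.
have vr : v != r by rewrite -distance_eq0 dv.
have [u uv] := distance_pred vr; rewrite dv => -[du].
have ux : u != x by apply: contraTneq lt_nx => <-; rewrite -du ltnn.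
apply: connect_trans (IHn u _ ux (ltnW lt_nx)) (connect1 _) => //.
by rewrite uv ux vx.
Qed.

(** Both neighbours are joined to the root without passing through [x], hence
    joined to each other. *)
Lemma lower_neighbour_unique x y z : adj x y -> adj x z ->
    (distance r y <= distance r x)%N -> (distance r z <= distance r x)%N ->
  y = z.
Proof.
move=> xy xz dy dz; apply: acyclic_avoid (xy) (xz) _.
have nx u : adj x u -> u != x by rewrite eq_sym; apply: adj_neq.
have e_sym : symmetric (fun u v : G => [&& adj u v, u != x & v != x]).
  by move=> u v; rewrite adj_sym [(u != x) && _]andbC.
apply: connect_trans (connect_avoid (nx _ xz) dz).
by rewrite (sym_connect_sym e_sym) connect_avoid ?nx.
Qed.

Definition child (x y : G) := adj x y && (distance r x < distance r y)%N.

Lemma child_inj x x' y : child x y -> child x' y -> x = x'.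
Proof.
move=> /andP[xy lxy] /andP[x'y lx'y].
by apply: (@lower_neighbour_unique y); rewrite 1?adj_sym // ltnW.
Qed.

Lemma child_distance x y : child x y -> distance r y = (distance r x).+1.
Proof.
by move=> /andP[xy lxy]; apply/eqP; rewrite eqn_leq lxy distance_adj.
Qed.

(** An edge inside a sphere would give its end [x] a second neighbour not
    farther than itself, besides the one on the way to the root. *)
Lemma adjE x y : adj x y = child x y || child y x.
Proof.
rewrite /child (adj_sym y x) -andb_orr; case xy: (adj x y) => //=.
rewrite -neq_ltn; apply/esym/negP=> /eqP dxy.
have nxr : x != r.
  apply: contraTneq xy => xr; move/eqP: dxy.
  by rewrite xr distance_refl eq_sym distance_eq0 => /eqP->; rewrite adj_irr.
have [z zx dx] := distance_pred nxr.
have zy : z = y.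
  by apply: (@lower_neighbour_unique x); rewrite ?dxy // 1?adj_sym // -dxy dx.
by move: dx; rewrite dxy zy => /n_Sn.
Qed.

(** The form in which the uniqueness of the parent enters the countings. *)
Lemma card_parents y : #|[pred x | child x y]| = (y != r).
Proof.
case: eqVneq => [->|nyr] /=.
  by apply: eq_card0 => x; rewrite inE /child distance_refl ltn0 andbF.
have [x xy dy] := distance_pred nyr.
have cxy : child x y by rewrite /child xy dy ltnS leqnn.
rewrite -(card1 x); apply: eq_card => z; rewrite !inE.
by apply/idP/eqP => [czy|-> //]; apply: child_inj czy cxy.
Qed.

Lemma degree_children x : degree x = (#|[pred y | child x y]| + (x != r))%N.
Proof.
rewrite -card_parents /degree cardsE -cardUI [X in (_ + X)%N]eq_card0 ?addn0.
  by apply: eq_card => y; rewrite !inE; apply: adjE.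
move=> y; rewrite !inE; apply/negP=> /andP[/andP[_ xy] /andP[_ yx]].
by have := ltn_trans xy yx; rewrite ltnn.
Qed.

(** Double counting of the pairs (parent, child) between consecutive
    spheres. *)
Lemma card_next_sphere n :
  #|[pred y | distance r y == n.+1]| =
  (\sum_(x | distance r x == n) #|[pred y | child x y]|)%N.
Proof.
rewrite -sum1_card.
under [RHS]eq_bigr do rewrite -sum1_card big_mkcond /=.
rewrite exchange_big big_mkcond /=; apply: eq_bigr => y _.
rewrite -big_mkcondr /= sum1_card inE.
case: eqP => [dy|ndy].
  have nyr : y != r by rewrite -distance_eq0 dy.
  (* The 1 counting [y] is the number of its parents. *)
  rewrite -[LHS]/(nat_of_bool true) -nyr -card_parents.
  apply: eq_card => x; rewrite !unfold_in /=.
  by apply/idP/andP=> [cxy|[]] //; rewrite -eqSS -(child_distance cxy) dy eqxx.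
rewrite eq_card0 // => x; rewrite !unfold_in; apply/negP=> /andP[/eqP dx cxy].
by apply: ndy; rewrite (child_distance cxy) dx.
Qed.

End RootedTree.

(** * The incidence matrix and the line graph *)

Section Incidence.

Variable G : sgraph.
Implicit Types (x y : G) (e f : edge G).

Lemma edge_setP (E : {set G}) :
  reflect (exists x y, adj x y /\ E = [set x; y]) (E \in edge_set G).
Proof.
rewrite inE; apply: (iffP existsP) => [[x /existsP[y /andP[xy /eqP EE]]]|].
  by exists x, y.
by move=> [x [y [xy ->]]]; exists x; apply/existsP; exists y; rewrite xy eqxx.
Qed.

Lemma card_edge e : #|val e| = 2%N.
Proof. by have /edge_setP[x [y [xy ->]]] := valP e; rewrite cards2 adj_neq. Qed.

Lemma card_edges_of (P : pred {set G}) :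
  #|[pred e : edge G | P (val e)]| = #|[set E in edge_set G | P E]|.
Proof.
rewrite -(@card_imset _ _ val _ val_inj); apply: eq_card => E.
rewrite in_set; apply/imsetP/andP => [[e Pe ->]|[EG PE]]; first by rewrite (valP e).
by exists (Sub E EG); rewrite ?inE ?SubK.
Qed.

Lemma card_incident x : #|[pred e : edge G | x \in val e]| = degree x.
Proof.
rewrite (card_edges_of (fun E => x \in E)) /degree.
rewrite -(@card_in_imset _ _ (fun y => [set x; y])).
  apply: eq_card => E; rewrite inE; apply/andP/imsetP => [[EG xE]|[y]].
    have /edge_setP[u [v [uv EE]]] := EG; move: xE; rewrite EE !inE.
    case/orP=> /eqP->; first by exists v; rewrite ?inE.
    by exists u; rewrite ?inE 1?adj_sym // setUC.
  rewrite inE => xy ->; rewrite !inE eqxx; split=> //.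
  by apply/existsP; exists x; apply/existsP; exists y; rewrite xy eqxx.
move=> y z; rewrite !inE => xy xz /setP/(_ y); rewrite !inE eqxx orbT.
by rewrite eq_sym (negPf (adj_neq xy)) /= => /esym/eqP.
Qed.

(** Two distinct vertices determine the edge through them. *)
Lemma card_incident2 x y : x != y ->
  #|[pred e : edge G | (x \in val e) && (y \in val e)]| = adj x y.
Proof.
move=> nxy; rewrite (card_edges_of (fun E => (x \in E) && (y \in E))).
have pairE (E : {set G}) :
    E \in edge_set G -> x \in E -> y \in E -> E = [set x; y].
  move=> EG xE yE; apply/esym/eqP; rewrite eqEcard subUset !sub1set xE yE.
  by rewrite (card_edge (Sub E EG : edge G)) cards2 nxy.
case xy: (adj x y) => /=.
  rewrite (_ : [set _ in _ | _] = [set [set x; y]]) ?cards1 //.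
  apply/setP=> E; rewrite in_set in_set1.
  apply/idP/eqP => [/and3P[EG xE yE]|->]; first exact: pairE.
  rewrite !inE !eqxx orbT !andbT; apply/existsP; exists x; apply/existsP.
  by exists y; rewrite xy eqxx.
apply: eq_card0 => E; rewrite in_set; apply/negP=> /and3P[EG xE yE].
have /edge_setP[u [v [uv EE]]] := EG; move: xE yE uv; rewrite EE !inE.
move=> /orP[] /eqP xu /orP[] /eqP yv; move: nxy; rewrite xu yv ?eqxx //.
  by rewrite -xu -yv xy.
by rewrite adj_sym -xu -yv xy.
Qed.

(** Two edges with two common vertices are equal. *)
Lemma card_edgeI e f :
  #|val e :&: val f| = (if e == f then 2 else line_adj e f)%N.
Proof.
rewrite /line_adj; case: eqVneq => [->|nef] /=; first by rewrite setIid card_edge.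
rewrite -card_gt0; case cI: #|val e :&: val f| => [|[|n]] //=.
case/eqP: nef; apply/val_inj.
have eI : val e :&: val f = val e.
  by apply/eqP; rewrite eqEcard subsetIl card_edge cI.
by apply/eqP; rewrite eqEcard !card_edge leqnn -{1}eI subsetIr.
Qed.

Definition incidence_matrix (K : pzSemiRingType) : 'M[K]_(#|G|, #|edge G|) :=
  \matrix_(i < #|G|, j < #|edge G|) (enum_val i \in val (enum_val j : edge G))%:R.

Lemma sum_enum_val_bool (K : pzSemiRingType) (T : finType) (P : pred T) :
  \sum_(i < #|T|) (P (enum_val i))%:R = #|P|%:R :> K.
Proof.
rewrite -natr_sum -sum1_card; congr _%:R.
rewrite [RHS]big_mkcond (big_enum_val (fun t => if t \in P then 1 else 0)%N) /=.
by apply: eq_bigr => i _; rewrite unfold_in; case: (P _).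
Qed.

Lemma incidence_mul_tr (K : comPzRingType) :
  incidence_matrix K *m (incidence_matrix K)^T =
  \matrix_(i, j) (if i == j then (degree (enum_val i))%:R
                  else (adj (enum_val i) (enum_val j))%:R).
Proof.
apply/matrixP=> i j; rewrite !mxE; under eq_bigr do rewrite !mxE -natrM mulnb.
rewrite (sum_enum_val_bool _ (fun e => (enum_val i \in val e) && (enum_val j \in val e))).
case: eqVneq => [->|nij]; last by rewrite card_incident2 ?(inj_eq enum_val_inj).
by rewrite -card_incident; congr _%:R; apply: eq_card => e; apply: andbb.
Qed.

Lemma tr_incidence_mul (K : comPzRingType) :
  (incidence_matrix K)^T *m incidence_matrix K =
  2%:M + adjacency_matrix K (line_graph G).
Proof.
apply/matrixP=> i j; rewrite !mxE; under eq_bigr do rewrite !mxE -natrM mulnb.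
rewrite (sum_enum_val_bool _ (fun x => (x \in val (enum_val i)) && (x \in val (enum_val j)))).
rewrite -cardsE -[[set _ | _]]/(val (enum_val i) :&: val (enum_val j)).
rewrite card_edgeI (inj_eq enum_val_inj) /=; case: eqVneq => [->|nij].
  by rewrite line_adj_irr addr0.
by rewrite mulr0n add0r.
Qed.

(** Exchange of [N^T N] and [N N^T], evaluated at [X + 2] to absorb the
    diagonal of [N^T N = 2 + A]. *)
Lemma char_poly_line_graph (K : comNzRingType) :
  ('X + 2) ^+ #|G| * char_poly (adjacency_matrix K (line_graph G)) =
  ('X + 2) ^+ #|edge G| *
  \det (\matrix_(i < #|G|, j < #|G|)
    (if i == j then 'X + 2 - (degree (enum_val i))%:R
     else - (adj (enum_val i) (enum_val j))%:R)) :> {poly K}.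
Proof.
rewrite /char_poly /char_poly_mx.
have -> : map_mx polyC (adjacency_matrix K (line_graph G)) =
          adjacency_matrix {poly K} (line_graph G).
  by apply/matrixP=> i j; rewrite !mxE polyC_natr.
have -> : 'X%:M - adjacency_matrix {poly K} (line_graph G) =
    ('X + 2)%:M - (incidence_matrix {poly K})^T *m incidence_matrix {poly K}.
  by rewrite tr_incidence_mul raddfD /= opprD addrA addrK.
rewrite -det_scalar_sub_mulmxC; congr (_ * \det _).
apply/matrixP=> i j; rewrite incidence_mul_tr !mxE.
by case: eqVneq => _; rewrite ?sub0r.
Qed.

Lemma handshake : (\sum_(x : G) degree x = #|edge G| * 2)%N.
Proof.
under eq_bigr do rewrite -card_incident -sum1_card big_mkcond /=.
rewrite exchange_big /= -sum_nat_const; apply: eq_bigr => e _.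
by rewrite -big_mkcond /= sum1_card -(card_edge e).
Qed.

End Incidence.

(** By the handshake lemma, as half the sum of the degrees: every vertex but
    the root has one parent, and there are as many children as parents in
    total. *)
Lemma card_edge_tree (G : sgraph) (r : G) : is_tree G -> #|G| = #|edge G|.+1.
Proof.
move=> treeG.
have sum_parents : (\sum_(x : G) (x != r) + 1 = #|G|)%N.
  rewrite -sum1_card (bigD1 r) //= eqxx add0n addnC [RHS](bigD1 r) //=.
  by congr (_ + _)%N; apply: eq_bigr => x ->.
have sum_children : (\sum_(x : G) #|[pred y | child r x y]| = \sum_(x : G) (x != r))%N.
  under eq_bigr do rewrite -sum1_card big_mkcond /=.
  rewrite exchange_big /=; apply: eq_bigr => y _.
  by rewrite -big_mkcond /= sum1_card -(card_parents r treeG).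
have := handshake G; under eq_bigr do rewrite (degree_children r treeG).
rewrite big_split /= sum_children.
move: (\sum_(x : G) (x != r))%N sum_parents => n <- /eqP.
by rewrite addnn -muln2 eqn_pmul2r // addn1 => /eqP->.
Qed.

Lemma char_poly_line_graph_tree (K : idomainType) (G : sgraph) (r : G) :
    is_tree G ->
  ('X + 2) * char_poly (adjacency_matrix K (line_graph G)) =
  \det (\matrix_(i < #|G|, j < #|G|)
    (if i == j then 'X + 2 - (degree (enum_val i))%:R
     else - (adj (enum_val i) (enum_val j))%:R)).
Proof.
move=> treeG; have := char_poly_line_graph G K.
have -> : ('X + 2 : {poly K}) ^+ #|G| = ('X + 2) ^+ #|edge G| * ('X + 2).
  by rewrite (card_edge_tree r treeG) exprSr.
rewrite -mulrA; apply: mulfI.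
by rewrite expf_neq0 // -polyC_natr monic_neq0 // monicXaddC.
Qed.

(** * The spheres of a Bethe tree *)

Section BetheTree.

Variables (k : nat) (d : nat -> nat) (G : sgraph) (r : G).
Hypothesis BetheG : generalized_Bethe_tree k d r.

Lemma Bethe_distance_lt x : (distance r x < k)%N.
Proof.
have [_ <- _] := BetheG.
exact: (leq_bigmax_cond (F := level r) x).
Qed.

Lemma Bethe_degree x : degree x = d (k - distance r x).
Proof.
have [_ _ ->] := BetheG; rewrite /level addn1 subnSK //.
exact: Bethe_distance_lt.
Qed.

Lemma card_children_Bethe x :
  #|[pred y | child r x y]| = (d (k - distance r x) - (x != r))%N.
Proof.
have [treeG _ _] := BetheG.
by rewrite -Bethe_degree (degree_children r treeG) addnK.
Qed.

(** Vertices at distance [n] have degree [d (k - n)] and, except for the root,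
    one parent: passing to the next sphere multiplies the cardinal by [d k] at
    the root and by [d (k - n) - 1] afterwards. *)
Lemma card_sphere_Bethe n : (n < k)%N ->
  #|[pred y | distance r y == n]| = bethe_m k d (k - n).
Proof.
have [treeG _ _] := BetheG.
elim: n => [|n IHn] ltnk.
  rewrite subn0 /bethe_m eqxx -(card1 r); apply: eq_card => y.
  by rewrite !inE (distance_eq0 _ treeG).
rewrite (card_next_sphere _ treeG).
rewrite (eq_bigr (fun=> d (k - n) - (0 < n))%N) => [|x /eqP dx]; last first.
  by rewrite card_children_Bethe -(distance_eq0 _ treeG) dx lt0n.
rewrite sum_nat_const IHn ?(ltnW ltnk) // /bethe_m.
have -> : (k - n.+1 == k)%N = false by lia.
have -> : (k - n == k)%N = (n == 0)%N by lia.
rewrite subnSK ?(ltnW ltnk) //; case: (eqVneq n 0%N) => [->|n_gt0].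
  by rewrite !subn0 big_geq // mul1n muln1.
rewrite lt0n n_gt0 [in RHS]big_ltn ?mulnA; last by lia.
by rewrite mulnAC.
Qed.

End BetheTree.

Lemma bethe_m_ge k d l :
    (forall i, (1 < i < k)%N -> (1 < d i)%N) -> (0 < d k)%N ->
    (0 < l < k)%N ->
  (bethe_m k d l.+1 <= bethe_m k d l)%N.
Proof.
move=> d_gt1 dk /andP[l_gt0 lt_lk]; rewrite /bethe_m (ltn_eqF lt_lk).
case: (eqVneq l.+1 k) => [lk|nlk]; first by rewrite lk big_geq // muln1.
have lt_l1k : (l.+1 < k)%N by rewrite ltn_neqAle nlk.
rewrite [X in (_ <= _ * X)%N]big_ltn // leq_mul2l leq_pmull ?orbT //.
by rewrite subn_gt0 d_gt1 // ltnS l_gt0.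
Qed.

(** The exponents come from the sizes of the spheres; the vertices at distance
    [j] from the root carry the index [k - j]. *)
Lemma prod_spheres (K : comNzRingType) k d (G : sgraph) (r : G) (f : nat -> K) :
    generalized_Bethe_tree k d r ->
  \prod_(x : G) f (k - distance r x)%N =
  \prod_(1 <= l < k.+1) f l ^+ bethe_m k d l.
Proof.
move=> BetheG.
rewrite (partition_big (fun x => Ordinal (Bethe_distance_lt BetheG x)) predT) //=.
rewrite big_add1 big_mkord [RHS](reindex_inj rev_ord_inj) /=.
apply: eq_bigr => j _; rewrite subnSK ?ltn_ord //.
rewrite -(card_sphere_Bethe BetheG) ?ltn_ord // -prodr_const.
by apply: eq_big => [x|x /eqP <-]; rewrite ?inE.
Qed.

(** * The polynomials of a Bethe tree *)

Lemma horner_natr (K : nzRingType) n (x : K) : (n%:R : {poly K}).[x] = n%:R.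
Proof. by rewrite -polyC_natr hornerC. Qed.

Section BethePolynomials.

Variables (R : rcfType) (k : nat) (d : nat -> nat).

Lemma bethe_gSS i : (i.+2 < k)%N ->
  bethe_g R k d i.+2 =
  ('X + 2 - (d i.+2)%:R) * bethe_g R k d i.+1
  - ((d i.+2)%:R - 1) * bethe_g R k d i.
Proof. by move=> lt_ik; rewrite /= (ltn_eqF lt_ik). Qed.

Lemma bethe_g_last i : i.+2 = k ->
  bethe_g R k d i.+2 =
  ('X + 2 - (d i.+2)%:R) * bethe_g R k d i.+1 - (d i.+2)%:R * bethe_g R k d i.
Proof. by move=> <-; rewrite /= eqxx. Qed.

(** With this sign the polynomials are positive far to the left. *)
Definition bethe_s l : {poly R} := (-1) ^+ l * bethe_g R k d l.

(** The quotient of [bethe_s (l - 1) - bethe_s l] by ['X + 2] for [0 < l < k]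
    (see bethe_sS).  Its recurrence has nonnegative coefficients as soon as the
    [d l] are positive, so positivity passes from [bethe_s] to it. *)
Fixpoint bethe_q l : {poly R} :=
  if l is l'.+1 then bethe_s l' + ((d l)%:R - 1) * bethe_q l' else 0.

Lemma bethe_qS l : bethe_q l.+1 = bethe_s l + ((d l.+1)%:R - 1) * bethe_q l.
Proof. by []. Qed.

Lemma bethe_sSS l : (l.+2 < k)%N ->
  bethe_s l.+2 =
  ((d l.+2)%:R - ('X + 2)) * bethe_s l.+1 - ((d l.+2)%:R - 1) * bethe_s l.
Proof. by move=> lt_lk; rewrite /bethe_s bethe_gSS // !exprS; ring. Qed.

Lemma bethe_sS l : (l.+1 < k)%N ->
  bethe_s l.+1 = bethe_s l - ('X + 2) * bethe_q l.+1.
Proof.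
elim: l => [|l IHl] lt_lk; first by rewrite /= /bethe_s /=; ring.
have sl : bethe_s l = bethe_s l.+1 + ('X + 2) * bethe_q l.+1.
  by rewrite IHl ?subrK // ltnW.
by rewrite bethe_sSS // bethe_qS sl; ring.
Qed.

(** The last recurrence has [d k] in place of [d k - 1] as second coefficient,
    which is what makes [- 2] a root of the last polynomial. *)
Lemma bethe_s_last l : l.+2 = k ->
  bethe_s k = - (('X + 2) * (bethe_s l.+1 + (d k)%:R * bethe_q l.+1)).
Proof.
move=> lk; have lt_lk : (l.+1 < k)%N by rewrite -lk.
have -> : bethe_s k =
    ((d k)%:R - ('X + 2)) * bethe_s l.+1 - (d k)%:R * bethe_s l.
  have gk := bethe_g_last lk; rewrite lk in gk.
  by rewrite /bethe_s gk -{1}lk !exprS; ring.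
have -> : bethe_s l = bethe_s l.+1 + ('X + 2) * bethe_q l.+1.
  by rewrite bethe_sS ?subrK.
by ring.
Qed.

Hypothesis d_gt0 : forall i, (0 < i < k)%N -> (0 < d i)%N.

Lemma bethe_q_ge0 (x : R) l : (l < k)%N ->
  (forall j, (j < l)%N -> 0 <= (bethe_s j).[x]) -> 0 <= (bethe_q l).[x].
Proof.
elim: l => [|l IHl] lt_lk s_ge0; first by rewrite /= horner0.
rewrite bethe_qS hornerD addr_ge0 ?s_ge0 // hornerM mulr_ge0 //.
  by rewrite hornerD hornerN horner_natr hornerC subr_ge0 ler1n d_gt0.
by apply: IHl => [|j /ltnW]; [exact: ltnW|exact: s_ge0].
Qed.

(** For [x <= -2] the factor [- (x + 2)] in bethe_sS is nonnegative, so the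
    values increase from [bethe_s 0 = 1]. *)
Lemma bethe_s_ge1 (x : R) l : (l < k)%N -> x <= -2 -> 1 <= (bethe_s l).[x].
Proof.
elim/ltn_ind: l => -[|l] IHl lt_lk x_le; first by rewrite /bethe_s mul1r hornerC.
rewrite bethe_sS // hornerD hornerN [(('X + 2) * _).[x]]hornerM hornerD hornerX horner_natr.
apply: le_trans (IHl l (leqnn _) (ltnW lt_lk) x_le) _.
rewrite lerDl -mulNr mulr_ge0 //.
  by rewrite oppr_ge0 -lerBrDr sub0r.
apply: bethe_q_ge0 => // j lt_jl; apply: le_trans ler01 (IHl j lt_jl _ x_le).
exact: ltn_trans lt_lk.
Qed.

Lemma bethe_g_neq0 l : (l < k)%N -> bethe_g R k d l != 0.
Proof.
move=> lt_lk; apply: contraTneq (bethe_s_ge1 lt_lk (lexx _)) => gl0.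
by rewrite /bethe_s gl0 mulr0 horner0 ler10.
Qed.

End BethePolynomials.

(** * The characteristic polynomial of the line graph *)

(** Induction on [n]: the new factor lowers the exponent of [g n.+1] from
    [m n.+1] to [m n.+1 - m n.+2]. *)
Lemma telescope_ratio (K : fieldType) (g : nat -> K) (m : nat -> nat) n :
    g 0 = 1 ->
    (forall l, (0 < l < n.+1)%N -> g l != 0 /\ (m l.+1 <= m l)%N) ->
  \prod_(1 <= l < n.+2) (g l / g l.-1) ^+ m l =
  \prod_(1 <= l < n.+1) g l ^+ (m l - m l.+1) * g n.+1 ^+ m n.+1.
Proof.
move=> g0; elim: n => [|n IHn] gm.
  by rewrite big_nat1 big_geq // g0 divr1 mul1r.
have [gn mn] : g n.+1 != 0 /\ (m n.+2 <= m n.+1)%N by apply: gm; rewrite ltnSn.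
rewrite big_nat_recr //= IHn => [|l /andP[l0 ln]]; last by apply: gm; rewrite l0 ltnW.
rewrite [in RHS]big_nat_recr //= -!mulrA; congr (_ * _).
by rewrite expr_div_n mulrCA mulrC expfB_cond ?(negPf gn).
Qed.

Lemma pivot_step (K : fieldType) (g0 g1 g2 w : K) e n :
    g0 != 0 -> g1 != 0 -> g2 = w * g1 - (n%:R - e) * g0 ->
  g2 / g1 + (n%:R - e) * (g1 / g0)^-1 = w.
Proof. by move=> g0n g1n ->; field; rewrite g0n. Qed.

(** The recurrence of the [bethe_g], read as the elimination step at a vertex
    that is not a leaf: the truncated difference is its number of children,
    which is its degree for the root and one less for the others. *)
Lemma bethe_g_ratio (R : rcfType) k d l (F := @tofrac {poly R}) :
    (forall i, (0 < i < k)%N -> (0 < d i)%N) -> (0 < d l.+2)%N -> (l.+1 < k)%N ->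
  F (bethe_g R k d l.+2) / F (bethe_g R k d l.+1) +
  (F (bethe_g R k d l.+1) / F (bethe_g R k d l))^-1 *+ (d l.+2 - (l.+2 != k)) =
  F ('X + 2 - (d l.+2)%:R).
Proof.
move=> d_gt0 dl lt_lk; rewrite {}/F.
have g_neq0 i : (i < k)%N -> tofrac (bethe_g R k d i) != 0.
  by move=> lt_ik; rewrite tofrac_eq0 bethe_g_neq0.
rewrite -[_ *+ (_ - _)]mulr_natl natrB; last by case: (_ != _).
apply: pivot_step; rewrite ?g_neq0 ?(ltnW lt_lk) //.
case: eqVneq => [lk|nlk].
  by rewrite bethe_g_last // !rmorphB !rmorphM !rmorph_nat subr0 rmorphB rmorph_nat.
have lt_l2k : (l.+2 < k)%N by rewrite ltn_neqAle nlk.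
rewrite bethe_gSS //.
by rewrite rmorphB !rmorphM !rmorphB rmorph_nat rmorph1.
Qed.

(** Elimination over the fraction field, with the pivot
    [bethe_g l / bethe_g (l - 1)] at the vertices at distance [k - l] from the
    root. *)
Lemma char_poly_Bethe_line_graph (R : rcfType) k d (G : sgraph) (r : G) :
    (forall i, (1 < i < k)%N -> (1 < d i)%N) -> d 1%N = 1%N -> (1 < k)%N ->
    (0 < d k)%N -> generalized_Bethe_tree k d r ->
  ('X + 2) * char_poly (adjacency_matrix R (line_graph G)) =
  \prod_(1 <= l < k.+1) bethe_g R k d l ^+ bethe_sigma k d l.
Proof.
move=> d_gt1 d1 k_gt1 dk BetheG; have [treeG _ _] := BetheG.
have d_gt0 i : (0 < i < k)%N -> (0 < d i)%N.
  by case: i => [|[|i]] // ik; [rewrite d1|apply/ltnW/d_gt1].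
pose F := @tofrac {poly R}; pose g l := F (bethe_g R k d l).
pose ratio l := g l / g l.-1.
have g_neq0 l : (l < k)%N -> g l != 0.
  by move=> lt_lk; rewrite tofrac_eq0 bethe_g_neq0.
have dist_lt x : (0 < k - distance r x)%N by rewrite subn_gt0 (Bethe_distance_lt BetheG).
rewrite (char_poly_line_graph_tree _ r treeG).
apply/eqP; rewrite -tofrac_eq; apply/eqP; rewrite -det_map_mx.
have -> : map_mx F (\matrix_(i < #|G|, j < #|G|)
    (if i == j then 'X + 2 - (degree (enum_val i))%:R
     else - (adj (enum_val i) (enum_val j))%:R)) =
  \matrix_(i < #|G|, j < #|G|)
    (if i == j then F ('X + 2 - (degree (enum_val i))%:R)
     else - (child r (enum_val i) (enum_val j) ||
             child r (enum_val j) (enum_val i))%:R).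
  apply/matrixP=> i j; rewrite !mxE; case: (i == j) => //.
  by rewrite /F rmorphN rmorph_nat (adjE r treeG).
rewrite (det_tree_elimination (h := fun i => distance r (enum_val i))
  (a := fun i => ratio (k - distance r (enum_val i : G))%N)); first last.
- move=> i; set x := enum_val i.
  rewrite (Bethe_degree BetheG).
  rewrite -(big_enum_val_cond (fun y => child r x y)
              (fun y => (ratio (k - distance r y)%N)^-1)) /=.
  rewrite (eq_bigr (fun=> (ratio (k - distance r x).-1)^-1)); last first.
    by move=> y cxy; rewrite (child_distance treeG cxy) subnS.
  rewrite sumr_const (card_children_Bethe BetheG).
  have -> : (x != r) = (k - distance r x != k)%N.
    rewrite -(distance_eq0 r treeG); have := dist_lt x; lia.
  (* [l = 1] is the case of a leaf, where the pivot is the diagonal entry. *)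
  case l_eq : (k - distance r x)%N (dist_lt x) => [|[|l]] //= _.
    rewrite d1 (ltn_eqF k_gt1) subnn mulr0n addr0 /ratio /g /= /F rmorph1 divr1.
    by congr (tofrac _); ring.
  rewrite /ratio /g /F -(bethe_g_ratio R (l := l) d_gt0) //.
    by case: (eqVneq l.+2 k) => [->|]; last by move=> nlk; apply: d_gt0; lia.
  lia.
- move=> i j /(child_distance treeG) dij; rewrite /ratio mulf_neq0 //.
    by rewrite g_neq0 // dij; lia.
  by rewrite invr_eq0 g_neq0 //; have := Bethe_distance_lt BetheG (enum_val j); lia.
- by move=> i i' j ci ci'; apply/enum_val_inj/(child_inj treeG ci ci').
- by move=> i j /(child_distance treeG) ->.
rewrite -(big_enum_val_cond predT (fun x => ratio (k - distance r x)%N)) /=.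
rewrite (prod_spheres ratio BetheG).
have := @telescope_ratio _ g (bethe_m k d) k.-1; rewrite prednK ?(ltnW k_gt1) //.
rewrite /ratio => ->; first last.
- by move=> l lk; rewrite g_neq0 ?bethe_m_ge //; case/andP: lk.
- by rewrite /g /F rmorph1.
rewrite big_nat_recr /=; last exact: ltnW.
rewrite /g /F rmorphM rmorph_prod; congr (_ * _); last first.
  by rewrite /bethe_sigma /bethe_m eqxx.
apply: eq_big_nat => l /andP[_ ln].
by rewrite rmorphXn /bethe_sigma (ltn_eqF ln).
Qed.

(** * The smallest eigenvalue *)

(** [next_root p c y] stops at [y] when the open interval from [c] to [y]
    contains no root, hence the preliminary root [y]. *)
Lemma first_root (R : rcfType) (p : {poly R}) (c b : R) :
    (forall x, x <= c -> 0 < p.[x]) -> p.[b] <= 0 ->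
  exists2 a, a <= b /\ root p a & forall x, x < a -> 0 < p.[x].
Proof.
move=> p_pos pb.
have p0 : p != 0 by apply: contraTneq (p_pos c (lexx c)) => ->; rewrite horner0 ltxx.
have root_le x : p.[x] <= 0 -> exists2 y, c < y <= x & root p y.
  move=> px; have lt_cx : c < x by rewrite ltNge; apply/negP => /p_pos; rewrite ltNge px.
  have := @polyrcf.poly_ivt _ p c x (ltW lt_cx); rewrite pmulr_rle0 ?p_pos // => /(_ px).
  case=> y /itvP y_cx py; exists y; rewrite // y_cx andbT lt_neqAle y_cx andbT.
  by apply: contraTneq py => <-; rewrite rootE gt_eqF ?p_pos.
have [y /andP[lt_cy le_yb] py] := root_le b pb.
case: (next_rootP p c y) => [/eqP|a _ pa0 a_cy noroot|a _ aE noroot].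
- by rewrite (negPf p0).
- exists a; first by rewrite (le_trans _ le_yb) ?(itvP a_cy) // rootE pa0 eqxx.
  move=> x lt_xa; rewrite ltNge; apply/negP => /root_le[z /andP[lt_cz le_zx]].
  by apply/negP/noroot; rewrite in_itv /= lt_cz (le_lt_trans le_zx).
- exists y => // x lt_xy; rewrite ltNge; apply/negP => /root_le[z /andP[lt_cz le_zx]].
  by apply/negP/noroot; rewrite in_itv /= lt_cz (le_lt_trans le_zx).
Qed.

(** Interlacing: at the smallest root [b] of [bethe_s l.+1] the recurrence gives
    [bethe_s l.+2] the sign opposite to that of [bethe_s l], which is positive
    there, while [bethe_s l.+2] is positive on the far left.  Its smallest root
    is therefore smaller than [b]. *)
Lemma bethe_first_root (R : rcfType) k d l :
    (forall i, (1 < i < k)%N -> (1 < d i)%N) -> (0 < d 1)%N ->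
    (l.+1 < k)%N ->
  exists a : R, [/\ root (bethe_s R k d l.+1) a, 0 < (bethe_s R k d l).[a] &
    forall x j, x < a -> (j < l.+2)%N -> 0 < (bethe_s R k d j).[x]].
Proof.
move=> d_gt1 d1 lt_lk.
have d_gt0 i : (0 < i < k)%N -> (0 < d i)%N.
  by case: i => [|[|i]] // lt_ik; apply/ltnW/d_gt1.
elim: l lt_lk => [|l IHl] lt_lk.
  have s0 x : (bethe_s R k d 0).[x] = 1 by rewrite /bethe_s mul1r hornerC.
  have s1 x : (bethe_s R k d 1).[x] = - 1 - x.
    by rewrite /bethe_s expr1 mulN1r hornerN /= hornerD hornerX hornerC opprD addrC.
  exists (- 1); split; rewrite ?rootE ?s0 ?s1 ?subrr //.
  by move=> x [|[|]] // lt_x _; rewrite ?s0 // s1 subr_gt0.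
have [b [sb0 sb1 sb]] := IHl (ltnW lt_lk).
have s2b : (bethe_s R k d l.+2).[b] < 0.
  rewrite bethe_sSS // hornerD hornerN [(_ * bethe_s R k d l.+1).[b]]hornerM.
  rewrite (rootP sb0) mulr0 sub0r oppr_lt0.
  rewrite hornerM hornerD hornerN horner_natr hornerC mulr_gt0 // subr_gt0.
  by rewrite ltr1n d_gt1.
have s2_pos x : x <= -2 -> 0 < (bethe_s R k d l.+2).[x].
  by move=> x_le; rewrite (lt_le_trans ltr01) ?bethe_s_ge1.
have [a [le_ab ra] sa] := first_root s2_pos (ltW s2b).
have lt_ab : a < b.
  rewrite lt_neqAle le_ab andbT; apply: contraTneq ra => ->.
  by rewrite rootE lt_eqF.
exists a; split=> // [|x j lt_xa]; first exact: sb.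
rewrite ltnS leq_eqVlt => /predU1P[->|lt_jl]; first exact: sa.
exact: sb (lt_trans lt_xa lt_ab) lt_jl.
Qed.

(** Dividing the product formula by ['X + 2]: the quotient of the last factor is
    explicit, and it is nonzero wherever the [bethe_s] of lower index are
    positive. *)
Lemma char_poly_Bethe_line_graph_factor (R : rcfType) l d (G : sgraph) (r : G)
    (k := l.+2) (g := bethe_g R k d) (s := bethe_s R k d) (q := bethe_q R k d) :
    (forall i, (1 < i < k)%N -> (1 < d i)%N) -> d 1%N = 1%N ->
    (0 < d k)%N -> generalized_Bethe_tree k d r ->
  char_poly (adjacency_matrix R (line_graph G)) =
  \prod_(1 <= i < k) g i ^+ bethe_sigma k d i *
  ((-1) ^+ l.+1 * (s l.+1 + (d k)%:R * q l.+1)).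
Proof.
move=> d_gt1 d1 dk BetheG.
have X2_neq0 : 'X + 2 != 0 :> {poly R}.
  by rewrite -polyC_natr monic_neq0 // monicXaddC.
apply: (mulfI X2_neq0); rewrite (char_poly_Bethe_line_graph _ d_gt1 d1 _ dk BetheG) //.
rewrite big_nat_recr // mulrCA; congr (_ * _).
have -> : bethe_sigma k d k = 1%N by rewrite /bethe_sigma eqxx.
have := @bethe_s_last R k d l erefl.
rewrite expr1 {1}/bethe_s => /(congr1 ( *%R ((-1) ^+ k))).
rewrite mulrA -expr2 sqrr_sign mul1r => ->.
by rewrite /k !exprS -/k -/s -/q; move: (s _) (q _) => u v; ring.
Qed.

Lemma eq_bethe_s (R : rcfType) k d d' l :
    (forall i, (1 <= i <= k - 1)%N -> d' i = d i) -> (l < k)%N ->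
  bethe_s R k d' l = bethe_s R k d l.
Proof.
move=> dE; rewrite /bethe_s => lt_lk; congr (_ * _).
elim/ltn_ind: l lt_lk => -[|[|l]] // IHl lt_lk.
by rewrite !bethe_gSS // !IHl ?dE //; lia.
Qed.

Lemma horner_bethe_g (R : rcfType) k d l (x : R) :
  (bethe_g R k d l).[x] = (-1) ^+ l * (bethe_s R k d l).[x].
Proof.
have -> : (-1) ^+ l = ((-1) ^+ l : {poly R}).[x].
  by rewrite -polyCN -polyC_exp hornerC.
by rewrite -hornerM /bethe_s mulrA -expr2 sqrr_sign mul1r.
Qed.

(** Left of [a] every factor of the characteristic polynomial is nonzero, and
    [a] is a root because the exponent of [bethe_g l.+1] is [d k - 1 > 0]. *)
Lemma smallest_eigenvalue_Bethe (R : rcfType) l d (a : R) (G : sgraph) (r : G)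
    (k := l.+2) (s := bethe_s R k d) :
    (forall i, (1 < i <= k)%N -> (1 < d i)%N) -> d 1%N = 1%N ->
    generalized_Bethe_tree k d r ->
    root (s l.+1) a ->
    (forall x j, x < a -> (j < k)%N -> 0 < (s j).[x]) ->
  smallest_eigenvalue (adjacency_matrix R (line_graph G)) a.
Proof.
move=> d_gt1 d1 BetheG sa s_pos.
have dk : (1 < d k)%N by apply: d_gt1; rewrite leqnn.
have d_gt1' i : (1 < i < k)%N -> (1 < d i)%N.
  by case/andP=> i_gt1 /ltnW ik; apply: d_gt1; rewrite i_gt1.
have d_gt0 i : (0 < i < k)%N -> (0 < d i)%N.
  by case: i => [|[|i]] // ik; [rewrite d1|apply/ltnW/d_gt1'].
have chi := char_poly_Bethe_line_graph_factor R d_gt1' d1 (ltnW dk) BetheG.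
have eigenvalueE b := eigenvalue_root_char (adjacency_matrix R (line_graph G)) b.
split=> [|b]; rewrite eigenvalueE chi rootM.
  have sigma_gt0 : (0 < bethe_sigma k d l.+1)%N.
    rewrite /bethe_sigma /bethe_m (ltn_eqF (ltnSn l.+1)) eqxx.
    by rewrite big_geq // muln1 subn_gt0.
  apply/orP; left; rewrite big_nat_recr // rootM; apply/orP; right.
  by rewrite /root horner_exp horner_bethe_g (rootP sa) mulr0 expr0n gtn_eqF.
apply: contraTT; rewrite -ltNge negb_or => lt_ba; apply/andP; split.
  rewrite /root horner_prod prodf_seq_neq0; apply/allP=> i.
  rewrite mem_index_iota => /andP[_ ik] /=.
  by rewrite horner_exp horner_bethe_g expf_neq0 // mulf_neq0 ?signr_eq0 // gt_eqF ?s_pos.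
rewrite rootM negb_or; apply/andP; split.
  by rewrite /root -polyCN -polyC_exp hornerC signr_eq0.
rewrite /root hornerD gt_eqF // ltr_pwDl ?s_pos //.
rewrite hornerM horner_natr mulr_ge0 ?ler0n // bethe_q_ge0 // => j lt_jl.
by rewrite ltW // s_pos // ltnW.
Qed.

Theorem theorem9 (R : rcfType) (k : nat) (d : nat -> nat) (hk : (2 <= k)%N)
    (hd1 : d 1%N = 1%N)
    (hd : forall i : nat, (2 <= i <= k - 1)%N -> (2 <= d i)%N)
    (hdk : (1 <= d k)%N) :
  (forall (G : sgraph) (r : G), generalized_Bethe_tree k d r ->
     ('X + 2%:R) * char_poly (adjacency_matrix R (line_graph G)) =
     \prod_(1 <= l < k.+1) bethe_g R k d l ^+ bethe_sigma k d l)
  /\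
  (exists a : R,
     forall d' : nat -> nat,
       (forall i : nat, (1 <= i <= k - 1)%N -> d' i = d i) ->
       (2 <= d' k)%N ->
       forall (G : sgraph) (r : G), generalized_Bethe_tree k d' r ->
         smallest_eigenvalue (adjacency_matrix R (line_graph G)) a).
Proof.
have d_gt1 i : (1 < i < k)%N -> (1 < d i)%N by move=> ik; apply: hd; lia.
split=> [G r|]; first exact: char_poly_Bethe_line_graph.
case: k hk d_gt1 {hd hdk} => [|[|l]] // _ d_gt1.
have d1_gt0 : (0 < d 1)%N by rewrite hd1.
have [a [sa _ s_pos]] := bethe_first_root R d_gt1 d1_gt0 (ltnSn l.+1).
exists a => d' dE d'k G r BetheG.
have sE j : (j < l.+2)%N -> bethe_s R l.+2 d' j = bethe_s R l.+2 d j.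
  exact: eq_bethe_s.
apply: smallest_eigenvalue_Bethe BetheG _ _.
- move=> i /andP[i_gt1]; rewrite leq_eqVlt => /predU1P[-> //|ik].
  by rewrite dE ?d_gt1 ?i_gt1 //; lia.
- by rewrite dE.
- by rewrite sE.
- by move=> x j lt_xa jl; rewrite sE // s_pos.
Qed.
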